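(* Let $G=(V,E)$ be a connected, $d$-regular graph on $n$ vertices, let $A$ be its adjacency matrix and $D = d\cdot I_n$ the diagonal matrix of vertex degrees, and let $1 = \lambda_1 \geq |\lambda_2| \geq \dots \geq |\lambda_n| \geq 0$ be the eigenvalues of the symmetric matrix $AD^{-1}$, ordered by absolute value. Let $1 \leq \ell \leq n-1$. Then there exists a probability measure $\mu_0$ on $V$ supported on at most $\ell$ vertices such that the sequence of measures defined by $\mu_{k+1} = AD^{-1}\mu_k$ satisfies, for all integers $k \geq 0$, $$\sum_{v\in V}\left|\mu_k(v) - \frac{1}{n}\right|^2 \leq \lambda_{\ell+1}^{2k}.$$
   Context: Probability measures on $V=\{v_1,\dots,v_n\}$ are identified with vectors in $\mathbb{R}^n_{\geq 0}$ whose entries sum to $1$; the support of a measure is the set of vertices with nonzero mass. $AD^{-1}=\frac1d A$ acts on such vectors by matrix multiplication (this is one step of the simple random walk). *)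

(* Defs.v *)
From HB Require Import structures.
From mathcomp Require Import all_boot all_order all_algebra.
From mathcomp Require Import reals.
Set Implicit Arguments. Unset Strict Implicit. Unset Printing Implicit Defensive.
Import Order.TTheory GRing.Theory Num.Theory.
Local Open Scope ring_scope.

Definition simple_graph n (e : rel 'I_n) :=
  symmetric e /\ irreflexive e.

Definition regular n (e : rel 'I_n) (d : nat) :=
  forall v : 'I_n, #|[set w | e v w]| = d.

Definition connected_graph n (e : rel 'I_n) :=
  forall u v : 'I_n, connect e u v.

Definition adj_mx (R : nzRingType) n (e : rel 'I_n) : 'M[R]_n :=
  \matrix_(i, j) (e i j)%:R.

Definition walk_mx (R : fieldType) n (e : rel 'I_n) (d : nat) : 'M[R]_n :=
  adj_mx R e *m invmx (d%:R%:M : 'M[R]_n).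

Definition prob_measure (R : numDomainType) n (mu : 'cV[R]_n) :=
  (forall v, 0 <= mu v 0) /\ \sum_v mu v 0 = 1.

Definition msupport (R : nzRingType) n (mu : 'cV[R]_n) : {set 'I_n} :=
  [set v | mu v 0 != 0].

Definition walk (R : fieldType) n (e : rel 'I_n) (d : nat) (mu0 : 'cV[R]_n) (k : nat)
  : 'cV[R]_n := iter k (mulmx (walk_mx R e d)) mu0.

(* Main.v *)
(** The operator [W = A D^-1] is symmetric with [W 1 = 1], so it has an
    orthonormal eigenbasis [p_0 = 1/sqrt n, p_1, ..., p_(n-1)] whose eigenvalues
    after the first are those of [lam] with one occurrence of 1 removed, still
    decreasing in absolute value. The uniform measure solves the [l] linear
    equations [<p_j, mu> = <p_j, uniform>], [j < l]; a nonnegative solution of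
    minimal support has at most [l] nonzero entries (Caratheodory), and the
    equation for [j = 0] makes it a probability measure. Its deviation from
    uniform lies in the span of [p_l, ..., p_(n-1)], on which [W^k] contracts by
    [|lam_l|^k], and has norm at most 1. *)

Require Import Defs.
From HB Require Import structures.
From mathcomp Require Import all_boot all_order all_algebra.
From mathcomp Require Import reals.
From mathcomp Require Import ring lra.
Import Order.TTheory GRing.Theory Num.Theory.
Local Open Scope ring_scope.

(** * Orthogonal diagonalisation of symmetric matrices *)

Lemma char_poly_conj (R : comNzRingType) n (P Q A : 'M[R]_n) :
  Q *m P = 1%:M -> char_poly (P *m A *m Q) = char_poly A.
Proof.
move=> QP; have PQ := mulmx1C QP.
rewrite /char_poly.
have -> : char_poly_mx (P *m A *m Q) =
  map_mx polyC P *m char_poly_mx A *m map_mx polyC Q.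
  rewrite /char_poly_mx !map_mxM mulmxBr mulmxBl; congr (_ - _).
  by rewrite mul_mx_scalar -scalemxAl -map_mxM PQ map_mx1 scalemx1.
by rewrite !det_mulmx mulrAC -det_mulmx -map_mxM PQ map_mx1 det1 mul1r.
Qed.

Lemma char_poly_block_diag (R : comNzRingType) m n (A : 'M[R]_m) (B : 'M_n) :
  char_poly (block_mx A 0 0 B) = char_poly A * char_poly B.
Proof. by rewrite /char_poly char_block_diag_mx det_ublock. Qed.

Lemma char_poly11 (R : comNzRingType) (x : R) : char_poly (x%:M : 'M_1) = 'X - x%:P.
Proof. by rewrite /char_poly det_mx11 !mxE eqxx !mulr1n. Qed.

Lemma mulmx_tr_row (R : comNzRingType) n (u : 'rV[R]_n) : u *m u^T = (\sum_j u 0 j ^+ 2)%:M.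
Proof.
by rewrite [LHS]mx11_scalar mxE; congr (_%:M); apply: eq_bigr => j _; rewrite mxE.
Qed.

Lemma row_sum_sq_eq0 (R : realDomainType) n (u : 'rV[R]_n) :
  (\sum_j u 0 j ^+ 2 == 0) = (u == 0).
Proof.
apply/eqP/eqP => [s0|->]; last by apply: big1 => j _; rewrite mxE expr0n.
apply/rowP => j; rewrite mxE; apply/eqP.
have := psumr_eq0P (fun j _ => sqr_ge0 (u 0 j)) s0.
by move/(_ j isT)/eqP; rewrite sqrf_eq0.
Qed.

Lemma orthogonal_completion (R : realFieldType) n (u : 'rV[R]_(1 + n)) : u *m u^T = 1%:M ->
  exists2 H : 'M_(1 + n), H *m H^T = 1%:M & row 0 H = u.
Proof.
move=> u1.
set e0 : 'rV[R]_(1+n) := delta_mx 0 0.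
(* When [u = e0], the vector [w] below vanishes and defines no reflection. *)
have [->|wn0] := eqVneq u e0.
  by exists 1%:M; rewrite ?trmx1 ?mulmx1 // row1.
(* Take for [H] the Householder reflection exchanging [u] and [e0]. *)
set w := u - e0; set c := \sum_j w 0 j ^+ 2.
have c0 : c != 0 by rewrite row_sum_sq_eq0 subr_eq0.
have ww : w *m w^T = c%:M by rewrite mulmx_tr_row.
have e0w (v : 'rV[R]_(1+n)) : e0 *m v^T = (v 0 0)%:M.
  by rewrite -rowE [LHS]mx11_scalar !mxE.
have e0u : u *m e0^T = (u 0 0)%:M by rewrite -[LHS]trmxK trmx_mul trmxK e0w tr_scalar_mx.
have cE : c = 2 - 2 * u 0 0.
  have : c%:M = (2 - 2 * u 0 0)%:M :> 'M_1.
    rewrite -ww /w linearB /= mulmxBl !mulmxBr u1 !e0w e0u mxE eqxx -!raddfB /=.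
    by congr (_%:M); ring.
  by move/matrixP/(_ 0 0); rewrite !mxE.
exists (1%:M - (2 / c) *: (w^T *m w)).
  have symM : (w^T *m w)^T = w^T *m w by rewrite trmx_mul trmxK.
  have MM : w^T *m w *m (w^T *m w) = c *: (w^T *m w).
    by rewrite mulmxA -(mulmxA w^T) ww mul_mx_scalar -scalemxAl.
  move: (w^T *m w) symM MM => M symM MM.
  have -> : (1%:M - (2 / c) *: M)^T = 1%:M - (2 / c) *: M.
    by rewrite linearB /= trmx1; congr (_ - _); rewrite linearZ /= symM.
  rewrite mulmxBl !mulmxBr !mulmx1 mul1mx.
  rewrite -scalemxAr -scalemxAl MM !scalerA.
  have -> : 2 / c * (2 / c) * c = 2 / c + 2 / c by field.
  by rewrite scalerDl opprB addrK subrK.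
rewrite rowE -/e0 mulmxBr mulmx1 -scalemxAr mulmxA e0w mul_scalar_mx scalerA.
have -> : w 0 0 = u 0 0 - 1 by rewrite /w !mxE !eqxx.
rewrite (_ : 2 / c * _ = -1) ?scaleN1r ?opprK /w 1?addrC ?subrK //.
apply: (mulIf c0); rewrite mulrAC mulfVK // cE; ring.
Qed.

(** Deflation: symmetry clears the first column along with the first row, leaving a smaller
    symmetric block to diagonalise. *)
Lemma sym_block_row0 (R : pzRingType) n (B : 'M[R]_(1 + n)) x :
  B^T = B -> row 0 B = x *: delta_mx 0 0 -> B = block_mx x%:M 0 0 (drsubmx B).
Proof.
move=> symB B0.
have ur : ursubmx B = 0.
  apply/rowP => j; have /rowP/(_ (rshift 1 j)) := B0; rewrite !mxE /= mulr0 => <-.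
  by congr (B _ _); apply: val_inj.
rewrite -[LHS]submxK ur; congr block_mx.
  rewrite [LHS]mx11_scalar; congr (_%:M).
  have /rowP/(_ 0) := B0; rewrite !mxE /= mulr1 => <-.
  by congr (B _ _); apply: val_inj.
by rewrite -[dlsubmx B]trmxK trmx_dlsub symB ur trmx0.
Qed.

(* The first eigenvector and the order of the eigenvalues are prescribed; the
   factorisation of the characteristic polynomial keeps everything over [R]. *)
Lemma sym_orthogonal_diag (R : rcfType) n (A : 'M[R]_n.+1) (u : 'rV_n.+1) x s :
  A^T = A -> u *m u^T = 1%:M -> u *m A = x *: u ->
  char_poly A = \prod_(y <- x :: s) ('X - y%:P) ->
  exists P : 'M_n.+1,
    [/\ P *m P^T = 1%:M, row 0 P = u & P *m A = diag_mx (\row_j (x :: s)`_j) *m P].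
Proof.
elim: n A u x s => [|n IH] A u x s symA u1 uA chA;
  have [H H1 H0] := @orthogonal_completion R _ u u1.
  exists H; split => //.
  have -> : H = u by rewrite -H0; apply/rowP => j; rewrite mxE !ord1.
  rewrite uA; apply/rowP => j; rewrite !mxE big_ord1 !mxE !ord1 eqxx /=.
  by rewrite mulr1n.
have H2 := mulmx1C H1.
pose B : 'M[R]_(1 + n.+1) := H *m A *m H^T.
have symB : B^T = B by rewrite /B !trmx_mul trmxK symA mulmxA.
pose A' := drsubmx B.
have B0 : row 0 B = x *: delta_mx 0 0.
  by rewrite /B !row_mul H0 uA -scalemxAl -H0 -row_mul H1 row1.
have BE : B = block_mx x%:M 0 0 A' by apply: sym_block_row0.
have symA' : A'^T = A' by rewrite /A' trmx_drsub symB.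
have chA' : char_poly A' = \prod_(y <- s) ('X - y%:P).
  have : char_poly B = char_poly A by rewrite /B char_poly_conj.
  rewrite BE char_poly_block_diag char_poly11 chA big_cons; apply: mulfI.
  by rewrite polyXsubC_eq0.
(* [A'] has positive size, so [s] is nonempty; its head is a root of [char_poly A'] and so has an
   eigenvector over [R]. *)
case: s => [|y s] in chA chA' *.
  have : size (char_poly A') = n.+2 by rewrite size_char_poly.
  by rewrite chA' big_nil size_polyC oner_eq0.
have : eigenvalue A' y by rewrite eigenvalue_root_char chA' root_prod_XsubC inE eqxx.
case/eigenvalueP => v vA v0.
pose r := Num.sqrt (\sum_j v 0 j ^+ 2).
have r2 : r ^+ 2 = \sum_j v 0 j ^+ 2.
  by rewrite sqr_sqrtr // sumr_ge0 // => j _; exact: sqr_ge0.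
have r0 : r != 0 by rewrite -sqrf_eq0 r2 row_sum_sq_eq0.
have v1 : (r^-1 *: v) *m (r^-1 *: v)^T = 1%:M.
  rewrite mulmx_tr_row (_ : \sum_j _ = 1) //; transitivity (r ^- 2 * \sum_j v 0 j ^+ 2).
    by rewrite mulr_sumr; apply: eq_bigr => j _; rewrite mxE exprMn exprVn.
  by rewrite -r2 mulVf // sqrf_eq0.
have vA' : (r^-1 *: v) *m A' = y *: (r^-1 *: v).
  by rewrite -scalemxAl vA !scalerA mulrC.
have [P [P1 P0 PA]] := IH A' (r^-1 *: v) y s symA' v1 vA' chA'.
pose C : 'M[R]_(1 + n.+1) := block_mx 1%:M 0 0 P.
have C1 : C *m C^T = 1%:M.
  rewrite /C tr_block_mx !trmx0 trmx1 mulmx_block !mul0mx !mulmx0 mulmx1 P1 !addr0 add0r.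
  by rewrite -scalar_mx_block.
have C0 : row 0 C = delta_mx 0 0.
  apply/rowP => j; rewrite !mxE; case: splitP => // i _; rewrite mxE; case: splitP => k.
    by rewrite !ord1 mxE eqxx => jk; rewrite (_ : j = 0) //; apply: val_inj; rewrite /= jk.
  by rewrite mxE => jk; rewrite (_ : j == 0 = false) // -val_eqE /= jk.
pose D : 'rV[R]_(1 + n.+1) := row_mx x%:M (\row_j (y :: s)`_j).
have CB : C *m B = diag_mx D *m C.
  rewrite diag_mx_row BE /C !mulmx_block !mul0mx !mulmx0 !mulmx1 !mul1mx PA !addr0 !add0r.
  congr (block_mx _ _ _ _).
  by apply/matrixP => i j; rewrite !ord1 !mxE.
have CHA : C *m H *m A = diag_mx D *m (C *m H).
  have HA : H *m (A : 'M_(1 + n.+1)) = B *m H by rewrite /B -[RHS]mulmxA H2 mulmx1.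
  transitivity (C *m B *m H); first by rewrite -(mulmxA C B) -(mulmxA C H); congr (C *m _).
  by rewrite CB -mulmxA.
have <- : D = \row_j [:: x, y & s]`_j.
  apply/rowP => j; rewrite /D !mxE; case: splitP => k; rewrite !mxE => jk.
    by rewrite ord1 jk ord1 /=.
  by rewrite jk.
exists (C *m H); split => //.
- by rewrite trmx_mul mulmxA -(mulmxA _ H) H1 mulmx1.
- by rewrite row_mul C0 -rowE.
Qed.

(** * Sparse nonnegative solutions of linear systems *)

(** The columns of [M] indexed by [S] outnumber its rows, hence are dependent; [z] is a relation
    among them, extended by zero. *)
Lemma kernel_in_support (F : fieldType) m n (M : 'M[F]_(m, n)) (S : {set 'I_n}) :
  (m < #|S|)%N -> exists z : 'cV_n, [/\ z != 0, M *m z = 0 & msupport z \subset S].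
Proof.
move=> mS; pose N := rowsub (enum_val : 'I_#|S| -> _) M^T.
have : kermx N != 0.
  rewrite kermx_eq0 /row_free neq_ltn; apply/orP; left.
  exact: leq_ltn_trans (rank_leq_col N) mS.
case/rowV0Pn => y yK y0.
have yN : y *m N = 0 by apply/eqP; rewrite -sub_kermx.
pose E : 'M[F]_(#|S|, n) := rowsub enum_val 1%:M.
exists (y *m E)^T; split.
- apply: contra y0 => /eqP/(congr1 trmx); rewrite trmxK trmx0 => yE0.
  apply/eqP/rowP => i; have /rowP/(_ (enum_val i)) := yE0.
  rewrite !mxE (bigD1 i) //= !mxE eqxx mulr1 big1 ?addr0 // => j ji.
  by rewrite !mxE (inj_eq enum_val_inj) (negPf ji) mulr0.
- by rewrite -[LHS]trmxK trmx_mul trmxK -mulmxA -rowsubE yN trmx0.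
apply/subsetP => v; rewrite inE; apply: contraR => vS.
rewrite !mxE big1 // => j _; rewrite !mxE; case: eqP => [jv|]; last by rewrite mulr0.
by rewrite -jv enum_valP in vS.
Qed.

(** Caratheodory reduction: while the support has more than [m] elements, move along a kernel vector
    carried by it until an entry vanishes. *)
Lemma sparse_nonneg_solution (R : realFieldType) m n (M : 'M[R]_(m, n)) (x : 'cV_n) :
  (forall v, 0 <= x v 0) ->
  exists y : 'cV_n, [/\ forall v, 0 <= y v 0, M *m y = M *m x & (#|msupport y| <= m)%N].
Proof.
have [k] := ubnP #|msupport x|; elim: k x => // k IH x xk x0.
have [|mS] := leqP #|msupport x| m; first by exists x.
have [z [z0 Mz zS]] := @kernel_in_support _ _ _ M _ mS.
wlog [i zi] : z z0 Mz zS / exists i, 0 < z i 0.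
  move=> W; have /cV0Pn[i] := z0.
  case: (ltgtP (z i 0) 0) => // zi _; last by apply: (W z) => //; exists i.
  apply: (W (- z)); rewrite ?oppr_eq0 ?mulmxN ?Mz ?oppr0 //.
    by apply: subset_trans zS; apply/subsetP => v; rewrite !inE mxE oppr_eq0.
  by exists i; rewrite mxE oppr_gt0.
(* Subtract the largest multiple of [z] that keeps [x] nonnegative. *)
case: (@arg_minP _ R _ i (fun v => 0 < z v 0) (fun v => x v 0 / z v 0) zi) => j zj jmin.
pose t := x j 0 / z j 0.
have t0 : 0 <= t by rewrite divr_ge0 // ltW.
have yE v : (x - t *: z) v 0 = x v 0 - t * z v 0 by rewrite !mxE.
case: (IH (x - t *: z)) => [|v|y [y0 My ym]].
(* Entry [j] becomes 0 and entries off the support of [x] stay 0, so the support shrinks. *)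
- rewrite ltnS in xk; apply: leq_trans xk; apply: proper_card; apply/properP; split.
    apply/subsetP => v; rewrite !inE yE; apply: contra => /eqP xv.
    have : v \notin msupport z by apply: contraTN (introT eqP xv) => /(subsetP zS); rewrite inE.
    by rewrite inE negbK => /eqP ->; rewrite xv mulr0 subr0.
  exists j; first by apply: (subsetP zS); rewrite inE gt_eqF.
  by rewrite !inE yE /t divfK ?subrr ?eqxx // gt_eqF.
- rewrite yE subr_ge0; have [zv|zv] := ltP 0 (z v 0).
    by rewrite -ler_pdivlMr // jmin.
  by apply: le_trans (x0 v); apply: mulr_ge0_le0.
exists y; split => //.
by rewrite My mulmxBr -scalemxAr Mz scaler0 subr0.
Qed.

(** * The walk matrix and its eigenvalues *)

Lemma walk_mxE (F : fieldType) n (e : rel 'I_n) d i j :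
  walk_mx F e d i j = (e i j)%:R / d%:R.
Proof. by rewrite /walk_mx invmx_scalar mul_mx_scalar !mxE mulrC. Qed.

Lemma walk_mx_sym (F : fieldType) n (e : rel 'I_n) d :
  simple_graph e -> (walk_mx F e d)^T = walk_mx F e d.
Proof. by case=> esym _; apply/matrixP => i j; rewrite mxE !walk_mxE esym. Qed.

Lemma walk_mx_row_sum (F : numFieldType) n (e : rel 'I_n) d i :
  regular e d -> (0 < d)%N -> \sum_j walk_mx F e d i j = 1.
Proof.
move=> ed d0; under eq_bigr do rewrite walk_mxE.
rewrite -mulr_suml -natr_sum (_ : \sum_j _ = d)%N ?divff // ?pnatr_eq0 -?lt0n //.
rewrite -(ed i) -sum1_card [RHS]big_mkcond; apply: eq_bigr => j _.
by rewrite inE; case: (e i j).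
Qed.

(** Right multiplication by a stochastic matrix does not increase the l1 norm of a row vector, in
    particular of an eigenvector. *)
Lemma stochastic_eigenvalue (R : realFieldType) n (A : 'M[R]_n) a :
  (forall i j, 0 <= A i j) -> (forall i, \sum_j A i j = 1) ->
  eigenvalue A a -> `|a| <= 1.
Proof.
move=> A0 A1 /eigenvalueP[v vA /rV0Pn[i vi]].
have s0 : 0 < \sum_j `|v 0 j|.
  by rewrite (bigD1 i) //= ltr_pwDl ?normr_gt0 // sumr_ge0.
rewrite -(ler_pM2r s0) mul1r mulr_sumr.
under eq_bigr => j _ do rewrite -normrM.
have -> : \sum_j `|v 0 j| = \sum_j \sum_k `|v 0 k| * A k j.
  by rewrite exchange_big; apply: eq_bigr => k _; rewrite -mulr_sumr A1 mulr1.
apply: ler_sum => j _; have /rowP/(_ j) := vA; rewrite !mxE => <-.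
apply: le_trans (ler_norm_sum _ _ _) _; apply: ler_sum => k _.
by rewrite normrM (ger0_norm (A0 _ _)).
Qed.

(* [a] has maximal absolute value but need not be the head of [s]: for a
   bipartite graph [lam] may start with [-1]. *)
Lemma nth_rem_sorted (R : realDomainType) (s : seq R) a l j :
  sorted (fun x y : R => `|y| <= `|x|) s -> a \in s ->
  (forall x, x \in s -> `|x| <= `|a|) -> (l <= j.+1 < size s)%N ->
  `|(rem a s)`_j| <= `|s`_l|.
Proof.
move=> ss sa amax /andP[lj js].
have mono p q : (p <= q < size s)%N -> `|s`_q| <= `|s`_p|.
  case/andP => pq qs.
  apply: (sorted_leq_nth _ _ _ ss) => //; last exact: (leq_ltn_trans pq).
  by move=> x y z /= yx; move/le_trans; apply.
have ia : (index a s < size s)%N by rewrite index_mem.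
(* From the removed position on, the entry is [s]_j.+1[and]l <= j.+1[. Before it,]l <= j.+1 <= index
   a s[, so the entry is bounded by]a[, which is bounded by]s[_l]. *)
rewrite remE nth_cat size_take ia; case: ltnP => ji; last first.
  by rewrite nth_drop addSn subnKC // mono // lj.
rewrite nth_take //; apply: le_trans (amax _ (mem_nth _ (ltnW js))) _.
by rewrite -{1}(nth_index 0 sa) mono // ia (leq_trans lj).
Qed.

Lemma connected_regular_gt0 n (e : rel 'I_n) d :
  regular e d -> connected_graph e -> (1 < n)%N -> (0 < d)%N.
Proof.
case: n e => [|[|n]] // e ed ce _; rewrite -(ed ord0) card_gt0.
have /connectP[[|w p] /=] := ce ord0 ord_max; first by move=> _ /(congr1 val).
by case/andP => ew _ _; apply/set0Pn; exists w; rewrite inE.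
Qed.

(** * Decay of the deviation from uniform in eigencoordinates *)

Lemma orthogonal_sum_sq (R : comNzRingType) n (P : 'M[R]_n) (z : 'cV_n) :
  P^T *m P = 1%:M -> \sum_j (P *m z) j 0 ^+ 2 = \sum_j z j 0 ^+ 2.
Proof.
move=> P1; have sq (w : 'cV_n) : \sum_j w j 0 ^+ 2 = (w^T *m w) 0 0.
  by rewrite mxE; apply: eq_bigr => j _; rewrite mxE.
by rewrite !sq trmx_mul mulmxA -(mulmxA _ P^T) P1 mulmx1.
Qed.

Theorem theorem1 (R : realType) (n d : nat) (e : rel 'I_n) (lam : seq R) (l : nat) :
  simple_graph e -> regular e d -> connected_graph e ->
  (* lam lists the eigenvalues of A D^{-1} with multiplicity, ordered by absolute value *)
  char_poly (walk_mx R e d) = \prod_(x <- lam) ('X - x%:P) ->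
  sorted (fun x y : R => `|y| <= `|x|) lam ->
  (1 <= l <= n - 1)%N ->
  exists mu0 : 'cV[R]_n,
    prob_measure mu0 /\ (#|msupport mu0| <= l)%N /\
    forall k : nat,
      \sum_(v < n) `|walk e d mu0 k v 0 - n%:R^-1| ^+ 2
        <= (nth 0 lam l) ^+ (2 * k).
Proof.
case: n e => [|n] e; first by case: l.
move=> se ed ce chW sl /andP[l0 ln]; rewrite subn1 /= in ln.
have d0 := connected_regular_gt0 _ _ _ ed ce (leq_trans l0 ln : (1 < n.+1)%N).
set W := walk_mx R e d in chW *.
have W1 i : \sum_j W i j = 1 by apply: walk_mx_row_sum.
have symW : W^T = W by apply: walk_mx_sym.
have W0 i j : 0 <= W i j by rewrite walk_mxE divr_ge0 // ler0n.
pose c : R := (Num.sqrt n.+1%:R)^-1.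
have cc : c ^+ 2 = n.+1%:R^-1 by rewrite exprVn sqr_sqrtr // ler0n.
have nn0 : n.+1%:R != 0 :> R by rewrite pnatr_eq0.
have nV : n.+1%:R^-1 *+ n.+1 = 1 :> R by rewrite -[LHS]mulr_natr mulVf.
have c0 : c != 0 by rewrite -sqrf_eq0 cc invr_eq0.
pose u : 'rV[R]_n.+1 := const_mx c.
have uu : u *m u^T = 1%:M.
  rewrite mulmx_tr_row; under eq_bigr do rewrite mxE.
  by rewrite sumr_const card_ord cc nV.
have uW : u *m W = 1 *: u.
  apply/rowP => j; rewrite scale1r !mxE -[RHS]mulr1 -(W1 j) mulr_sumr.
  by apply: eq_bigr => i _; rewrite -[in RHS]symW !mxE.
have ev x : eigenvalue W x = (x \in lam) by rewrite eigenvalue_root_char chW root_prod_XsubC.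
have lam1 : 1 \in lam.
  by rewrite -ev; apply/eigenvalueP; exists u => //; apply/rV0Pn; exists 0; rewrite mxE.
have lam_le x : x \in lam -> `|x| <= `|1 : R|.
  by rewrite -ev normr1; apply: stochastic_eigenvalue.
have szlam : size lam = n.+1.
  by have := size_char_poly W; rewrite chW size_prod_XsubC => -[].
(* With one occurrence of 1 in front, [u] can be prescribed as row 0 of the eigenbasis. *)
rewrite (perm_big _ (perm_to_rem lam1)) in chW.
have [P [P1 P0 PW]] := sym_orthogonal_diag _ _ _ _ _ _ symW uu uW chW.
have P2 := mulmx1C P1.
set D := \row_j _ in PW.
pose x : 'cV[R]_n.+1 := const_mx n.+1%:R^-1.
have Wx : W *m x = x.
  apply/colP => i; rewrite mxE; under eq_bigr do rewrite [x _ _]mxE.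
  by rewrite -mulr_suml W1 mul1r mxE.
(* The system consists of the first [l] rows of [P], and the uniform vector [x] solves it. *)
have [|y [y0 My ys]] := @sparse_nonneg_solution _ _ _ (rowsub (widen_ord (leqW ln)) P) x.
  by move=> v; rewrite mxE invr_ge0 ler0n.
pose z := y - x.
have Pzl (j : 'I_n.+1) : (j < l)%N -> (P *m z) j 0 = 0.
  move=> jl; have /colP/(_ (Ordinal jl)) := My.
  rewrite !mul_rowsub_mx mulmxBr [LHS]mxE [RHS]mxE.
  have -> : widen_ord (leqW ln) (Ordinal jl) = j by apply: val_inj.
  by move=> E; rewrite mxE [X in _ + X]mxE E subrr.
have y1 : \sum_v y v 0 = 1.
  (* Row 0 is among the equations because [0 < l]; it is constant, so it fixes the total mass. *)
  have : (u *m z) 0 0 = 0 by rewrite -P0 -row_mul mxE Pzl.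
  rewrite mxE; under eq_bigr do rewrite [u _ _]mxE.
  rewrite -mulr_sumr => /eqP; rewrite mulf_eq0 (negPf c0) /=.
  under eq_bigr do rewrite [z _ _]mxE [X in _ + X]mxE [x _ _]mxE.
  rewrite big_split /= sumr_const card_ord mulNrn nV subr_eq0.
  by move/eqP.
exists y; split; [by split | split=> [//|k]].
have walkE : walk e d y k - x = iter k (mulmx W) z.
  by elim: k => [//|k IH]; rewrite /walk !iterS -/W -/(walk e d y k) -IH mulmxBr Wx.
have PE j : (P *m iter k (mulmx W) z) j 0 = D 0 j ^+ k * (P *m z) j 0.
  elim: k {walkE} => [|k IH]; first by rewrite mul1r.
  by rewrite iterS mulmxA PW -mulmxA mul_diag_mx mxE IH exprS mulrA.
have -> : \sum_v `|walk e d y k v 0 - n.+1%:R^-1| ^+ 2 =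
    \sum_j (D 0 j ^+ k * (P *m z) j 0) ^+ 2.
  under [RHS]eq_bigr do rewrite -PE.
  rewrite orthogonal_sum_sq // -walkE; apply: eq_bigr => v _.
  by rewrite real_normK ?num_real // [in RHS]mxE [X in _ = (_ + X) ^+ _]mxE [x _ _]mxE.
have z1 : \sum_v z v 0 ^+ 2 <= 1.
  have n0 : 0 < n.+1%:R^-1 :> R by rewrite invr_gt0 ltr0n.
  have y_le1 v : y v 0 <= 1.
    by rewrite -y1 (bigD1 v) //= lerDl sumr_ge0.
  have zE v : z v 0 = y v 0 - n.+1%:R^-1 by rewrite mxE [X in _ + X]mxE [x _ _]mxE.
  (* This is [y^2 <= y] on [0, 1]. With N vertices, the bounds sum to 1 - 2/N + 1/N = 1 - 1/N. *)
  have sq v : z v 0 ^+ 2 <= y v 0 * (1 - 2 / n.+1%:R) + n.+1%:R^-1 ^+ 2.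
    by rewrite zE; have := y0 v; have := y_le1 v; move: (y v 0) _^-1 => a q; nra.
  apply: le_trans (ler_sum _ (fun v _ => sq v)) _.
  rewrite big_split /= -mulr_suml y1 mul1r sumr_const card_ord expr2 -mulrnAl nV.
  by move: n0; move: _^-1 => q; lra.
apply: (@le_trans _ _ (lam`_l ^+ (2 * k) * \sum_j (P *m z) j 0 ^+ 2)); last first.
  by rewrite orthogonal_sum_sq // ler_piMr // exprM exprn_ge0 // sqr_ge0.
rewrite mulr_sumr; apply: ler_sum => j _.
have [jl|lj] := ltnP j l; first by rewrite Pzl // mulr0 expr0n mulr0.
rewrite exprMn ler_wpM2r ?sqr_ge0 // -exprM mulnC !exprM lerXn2r ?nnegrE ?sqr_ge0 //.
rewrite -[leLHS]real_normK ?num_real // -[leRHS]real_normK ?num_real //.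
rewrite lerXn2r ?nnegrE // mxE.
(* The index 0 is excluded by [0 < l <= j]; entry [j.+1] of [1 :: rem 1 lam] is entry [j] of
   [rem 1 lam]. *)
case: j lj => [[|j] jn] /= lj; first by rewrite leqNgt l0 in lj.
by apply: nth_rem_sorted => //; rewrite lj szlam.
Qed.
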